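(* Let $G$ be a graph on $\{1,\dots,n\}$ and let $\mathbf c$ be a relative interior regular point of a fixed hull and contact class $X=\mathcal F\cap\mathcal C(G)$. If there exists $\delta\mathbf c\in\mathbf{Roll}(\mathbf c)$ such that $D\operatorname{Per}(\mathbf c)[\delta\mathbf c]<0$, then $\mathbf c$ is not class critical. In particular, $\mathbf c$ is not a local minimiser of $\operatorname{Per}$ on $X$.
   Context: $\mathcal D_n=\{\mathbf c\in(\mathbb R^2)^n:\|\mathbf c_i-\mathbf c_j\|\ge2\ \forall i\ne j\}$. For $\mathbf c\in\mathcal D_n$, $P(\mathbf c)=\operatorname{conv}\{\mathbf c_1,\dots,\mathbf c_n\}$ is the centre hull and $\operatorname{Per}(\mathbf c)$ is the length of the boundary of the convex hull of the union of the closed unit disks centred at $\mathbf c_1,\dots,\mathbf c_n$ (equal to $\operatorname{Per}(P(\mathbf c))+2\pi$). For a graph $G$ on $\{1,\dots,n\}$ with edge set $E(G)$: $\mathcal C(G)$ is the set of $\mathbf c\in\mathcal D_n$ with $\|\mathbf c_i-\mathbf c_j\|=2$ exactly for $\{i,j\}\in E(G)$ (and $>2$ for non-edges); $M(G)=\{\mathbf d\in(\mathbb R^2)^n:\|\mathbf d_i-\mathbf d_j\|=2\ \forall\{i,j\}\in E(G)\}$; $\mathbf d\in M(G)$ is regular for $G$ if the gradients at $\mathbf d$ of $g_{ij}(\mathbf d)=\|\mathbf d_j-\mathbf d_i\|^2-4$, $\{i,j\}\in E(G)$, are linearly independent. $\mathbf c$ is hull stable if all configurations of $\mathcal D_n$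 in some neighbourhood of $\mathbf c$ have a centre hull with the same set of hull vertex indices and the same cyclic order as $P(\mathbf c)$. For hull stable $\mathbf c\in\mathcal C(G)$ regular for $G$, let $\mathcal F$ be the set of configurations whose centre hull has the same hull vertex set and cyclic order as $P(\mathbf c)$, and let $\mathcal B$ be the list of oriented hull edges in cyclic order. A fixed hull and contact class is a set $X=\mathcal F\cap\mathcal C(G)$ of this form. A point $\mathbf c\in X$ is a relative interior regular point if it is regular for $G$ and there is an open neighbourhood $U_0$ of $\mathbf c$ in $(\mathbb R^2)^n$ with $\|\mathbf d_i-\mathbf d_j\|>2$ for all $\mathbf d\in U_0\cap M(G)$ and all $\{i,j\}\notin E(G)$, and $U_0\cap\mathcal D_n\subset\mathcal F$ (so that $X\cap U_0=M(G)\cap U_0$). $\widetilde{\operatorname{Per}}(\mathbf d)=\sum_{(i,j)\in\mathcal B}\|\mathbf d_j-\mathbf d_i\|+2\pi$, which is smooth near $\mathbf c$ and equals $\operatorname{Per}$ on $\mathcal F$; $D\operatorname{Per}(\mathbf c)$ denotes $D\widetilde{\operatorname{Per}}(\mathbf c)$. For $\{i,j\}\in E(G)$, $\mathbf u_{ij}=(\mathbf c_j-\mathbf c_i)/\|\mathbf c_j-\mathbf c_i\|$. The rolling space is $\mathbf{Roll}(\mathbf c)=\{\delta\mathbf c\in(\mathbb R^2)^n:\langle\mathbf u_{ij},\delta\mathbf c_j-\delta\mathbf c_i\rangle=0\ \forall\{i,j\}\in E(G)\}$. $\mathbf c$ is class critical if $D\operatorname{Per}(\mathbf c)[\eta]=0$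 for every $\eta\in\mathbf{Roll}(\mathbf c)$. *)

(* Defs.v *)
From HB Require Import structures.
From mathcomp Require Import all_boot all_order all_algebra.
From mathcomp Require Import all_classical all_reals all_analysis.
Set Implicit Arguments.
Unset Strict Implicit.
Unset Printing Implicit Defensive.
Import Order.TTheory GRing.Theory Num.Theory.
Import numFieldNormedType.Exports.

Local Open Scope classical_set_scope.
Local Open Scope ring_scope.

(* A configuration of n centres is a matrix c : 'M[R]_(n, 2) whose i-th row is
   the centre c_i; points of the plane are row vectors 'rV[R]_2. The library
   norm on matrices is the sup norm: it induces the usual topology, but
   distances below are measured with the Euclidean norm [enorm]. *)

Section Plane.
Context {R : realType}.
Implicit Types (u v p q x : 'rV[R]_2) (A K : set 'rV[R]_2).

Definition dotp u v : R := \sum_(l < 2) u 0 l * v 0 l.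

Definition enorm u : R := Num.sqrt (dotp u u).

Definition cross u v : R := u 0 0 * v 0 1 - u 0 1 * v 0 0.

Definition convex_hull A : set 'rV[R]_2 :=
  smallest (fun C : set 'rV[R]_2 => convex_set C) A.

Definition extreme_point K x : Prop :=
  K x /\ forall p q (t : R), K p -> K q -> 0 < t < 1 ->
    x = t *: p + (1 - t) *: q -> p = x /\ q = x.

Definition frontier A : set 'rV[R]_2 := closure A `\` interior A.

(* The points are in strictly convex position and listed counterclockwise.
   For at most two points there is no condition. *)
Definition ccw_convex (s : seq 'rV[R]_2) : Prop :=
  forall i j k : nat, (i < j)%N -> (j < k)%N -> (k < size s)%N ->
    0 < cross (s`_j - s`_i) (s`_k - s`_i).

End Plane.

(* (s_0, s_1), (s_1, s_2), ..., (s_{m-1}, s_0). A one-element list gives the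
   single pair (s_0, s_0), which has length 0 as an edge; a two-element list
   gives the segment traversed once in each direction. *)
Definition cyclic_pairs (T : Type) (s : seq T) : seq (T * T) :=
  zip s (rot 1 s).

Definition polygon_length {R : realType} (s : seq 'rV[R]_2) : R :=
  \sum_(e <- cyclic_pairs s) enorm (e.2 - e.1).

(* Arc length of the closed convex curve bounding the convex set K: the
   supremum of the lengths of the polygons inscribed in the curve, with
   vertices taken in their order along it. *)
Definition boundary_length {R : realType} (K : set 'rV[R]_2) : R :=
  sup [set polygon_length s | s in
    [set s | {in s, forall p, frontier K p} /\ ccw_convex s]].

Section Configurations.
Context {R : realType} {n : nat}.
Implicit Types (c d : 'M[R]_(n, 2)) (G : rel 'I_n) (s : seq 'I_n).

Definition dist c (i j : 'I_n) : R := enorm (row j c - row i c).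

Definition packing : set 'M[R]_(n, 2) :=
  [set c | forall i j, i != j -> 2 <= dist c i j].

Definition centre_hull c : set 'rV[R]_2 :=
  convex_hull (range (fun i => row i c)).

Definition disk_hull c : set 'rV[R]_2 :=
  convex_hull (\bigcup_i [set x | enorm (x - row i c) <= 1]).

Definition Per c : R := boundary_length (disk_hull c).

Definition contact_class G : set 'M[R]_(n, 2) :=
  [set c | packing c /\ forall i j, i != j ->
    (G i j -> dist c i j = 2) /\ (~~ G i j -> 2 < dist c i j)].

Definition contact_variety G : set 'M[R]_(n, 2) :=
  [set d | forall i j, G i j -> dist d i j = 2].

Definition gap (e : 'I_n * 'I_n) d : R := dist d e.1 e.2 ^+ 2 - 4.

Definition grad (f : 'M[R]_(n, 2) -> R) d : 'M[R]_(n, 2) :=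
  \matrix_(k, l) 'D_(delta_mx k l) f d.

(* Each unordered edge is listed once. *)
Definition edges G : seq ('I_n * 'I_n) :=
  [seq e : 'I_n * 'I_n <- enum {: 'I_n * 'I_n} | (e.1 < e.2)%N && G e.1 e.2].

Definition regular G d : Prop :=
  contact_variety G d /\ free [seq grad (gap e) d | e <- edges G].

Definition hull_vertex c (i : 'I_n) : Prop :=
  extreme_point (centre_hull c) (row i c).

(* s lists the hull vertex indices of c in counterclockwise cyclic order; such
   an s is determined by c up to rotation. *)
Definition hull_cycle c s : Prop :=
  [/\ uniq s, (forall i, i \in s <-> hull_vertex c i)
    & ccw_convex [seq row i c | i <- s]].

Definition hull_stable c : Prop :=
  exists s, hull_cycle c s /\
    \forall d \near c, packing d -> hull_cycle d s.

Definition hull_class s : set 'M[R]_(n, 2) :=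
  [set d | packing d /\ hull_cycle d s].

(* X is the class F /\ C(G) of some hull stable c0 in C(G) regular for G, and s
   is the cyclic order of its hull vertices. *)
Definition fixed_hull_contact_class G s (X : set 'M[R]_(n, 2)) : Prop :=
  exists c0, [/\ contact_class G c0, hull_stable c0, regular G c0,
    hull_cycle c0 s & X = hull_class s `&` contact_class G].

Definition relative_interior_regular_point G s (X : set 'M[R]_(n, 2)) c : Prop :=
  [/\ X c, regular G c & exists U0 : set 'M[R]_(n, 2),
    [/\ open U0, U0 c,
        (forall d, U0 d -> contact_variety G d ->
           forall i j, i != j -> ~~ G i j -> 2 < dist d i j)
      & U0 `&` packing `<=` hull_class s]].

Definition Per_tilde s d : R :=
  \sum_(e <- cyclic_pairs s) dist d e.1 e.2 + 2 * pi.

Definition DPer s c : 'M[R]_(n, 2) -> R := 'd (Per_tilde s) c.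

Definition unit_vec c (i j : 'I_n) : 'rV[R]_2 :=
  (dist c i j)^-1 *: (row j c - row i c).

Definition Roll G c : set 'M[R]_(n, 2) :=
  [set dc | forall i j, G i j ->
    dotp (unit_vec c i j) (row j dc - row i dc) = 0].

Definition class_critical G s c : Prop :=
  forall eta, Roll G c eta -> DPer s c eta = 0.

Definition local_minimiser (f : 'M[R]_(n, 2) -> R) (X : set 'M[R]_(n, 2)) c
    : Prop :=
  X c /\ \forall d \near c, X d -> f c <= f d.

End Configurations.

(* Main.v *)
(** Regularity lets one solve the contact equations near [c] along the rolling
    direction [dc]: by the contraction principle there are points
    [c + t dc + o(t)] in [M(G)], and for small [t] they lie in [X], while
    [Per_tilde] decreases to first order. It remains to identify [Per] with
    [Per_tilde] on the hull class, i.e. to prove Steiner's formula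
    [boundary_length (P + disk) = polygon_length P + 2 pi] for a convex polygon [P],
    the boundary length being a supremum over inscribed convex polygons.
    This is done by a discrete Crofton formula. For a convex polygon [Q], the
    edges seen in a direction [u] sweep its width twice,
    [sum_e |<e, u>| = 2 width_u Q]; conversely, summing [|<e, u>|] over the [2N]
    directions of the sides of a regular [2N]-gon gives the variation of
    [<., e>] around that [2N]-gon, which is [|e|] up to a universal factor and a
    relative error [O(1/N)]. Hence lengths are averages of widths. The widths of
    an inscribed polygon are at most [width_u P + 2], with equality in all [2N]
    directions for the polygon of support points. *)
Require Import Defs.
From HB Require Import structures.
From mathcomp Require Import all_boot all_order all_algebra.
From mathcomp Require Import all_classical all_reals all_analysis.
From mathcomp Require Import lra zify.
Set Implicit Arguments.
Unset Strict Implicit.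
Unset Printing Implicit Defensive.
Import Order.TTheory GRing.Theory Num.Theory.
Import numFieldNormedType.Exports.
Local Open Scope classical_set_scope.
Local Open Scope ring_scope.
(** * The plane *)

Section PlaneVectors.
Context {R : realType}.
Implicit Types (u v p q x y : 'rV[R]_2).

Lemma dotpE u v : dotp u v = u 0 0 * v 0 0 + u 0 1 * v 0 1.
Proof.
rewrite /dotp !big_ord_recl big_ord0 addr0.
by congr (_ + u 0 _ * v 0 _); apply/val_inj.
Qed.

Lemma eq_row2 u v : u 0 0 = v 0 0 -> u 0 1 = v 0 1 -> u = v.
Proof.
move=> e0 e1; apply/rowP => -[[|[|//]] i].
- by have -> : Ordinal i = 0 by apply/val_inj.
- by have -> : Ordinal i = 1 by apply/val_inj.
Qed.

Lemma dotpC u v : dotp u v = dotp v u.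
Proof. by rewrite !dotpE mulrC [u 0 1 * _]mulrC. Qed.

Lemma dotpDl u v w : dotp (u + v) w = dotp u w + dotp v w.
Proof. by rewrite !dotpE !mxE; lra. Qed.

Lemma dotpBl u v w : dotp (u - v) w = dotp u w - dotp v w.
Proof. by rewrite !dotpE !mxE; lra. Qed.

Lemma dotpZl (k : R) u w : dotp (k *: u) w = k * dotp u w.
Proof. by rewrite !dotpE !mxE; lra. Qed.

Lemma dotpNr u w : dotp u (- w) = - dotp u w.
Proof. by rewrite !dotpE !mxE; lra. Qed.

Lemma dotp_ge0 u : 0 <= dotp u u.
Proof. by rewrite dotpE -!expr2 addr_ge0 ?sqr_ge0. Qed.

Lemma enorm_ge0 u : 0 <= enorm u.
Proof. exact: sqrtr_ge0. Qed.

Lemma enorm_sqr u : enorm u ^+ 2 = dotp u u.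
Proof. by rewrite sqr_sqrtr ?dotp_ge0. Qed.

Lemma cauchy_schwarz u v : `|dotp u v| <= enorm u * enorm v.
Proof.
rewrite -ler_sqr ?nnegrE ?mulr_ge0 ?enorm_ge0 ?normr_ge0//.
rewrite -normrX ger0_norm ?sqr_ge0// exprMn !enorm_sqr !dotpE.
have := sqr_ge0 (cross u v); rewrite /cross.
by move: (u 0 0) (u 0 1) (v 0 0) (v 0 1) => a b c d; lra.
Qed.

Lemma ccw_convex_rcons (s : seq 'rV[R]_2) x :
  ccw_convex (rcons s x) -> ccw_convex s.
Proof.
move=> cs i j k ij jk ks.
have := cs i j k ij jk; rewrite size_rcons ltnS !nth_rcons.
by rewrite ks (ltn_trans jk ks) (ltn_trans ij (ltn_trans jk ks)) => /(_ (ltnW ks)).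
Qed.

End PlaneVectors.

(** * Variation of a linear function along a convex polygon *)

Section CyclicSums.
Context {R : realType} {T : eqType}.
Implicit Types (s t : seq T) (x y z : T).

Lemma cyclic_pairs_cons x t :
  cyclic_pairs (x :: t) = rcons (zip (belast x t) t) (last x t, x).
Proof. by rewrite /cyclic_pairs rot1_cons lastI zip_rcons ?size_belast. Qed.

(** Appending [y] replaces the closing edge from [last x t] to [x] by the two edges through [y]; the
    removed edge stands on the left to avoid a subtraction. *)
Lemma sum_cyclic_pairs_rcons (f : T * T -> R) x t y :
  \sum_(e <- cyclic_pairs (rcons (x :: t) y)) f e + f (last x t, x) =
  \sum_(e <- cyclic_pairs (x :: t)) f e + f (last x t, y) + f (y, x).
Proof.
rewrite rcons_cons !cyclic_pairs_cons belast_rcons last_rcons lastI.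
by rewrite zip_rcons ?size_belast// !big_rcons/=; lra.
Qed.

(** A closed walk through [z] and [w] goes from one to the other and back, and each half changes [a]
    by at least the difference. *)
Lemma variation_ge_diff (a : T -> R) s z w : z \in s -> w \in s ->
  2 * (a z - a w) <= \sum_(e <- cyclic_pairs s) `|a e.2 - a e.1|.
Proof.
case: s => // x t; rewrite cyclic_pairs_cons big_rcons/=.
elim/last_ind: t z w => [|t y ih] z w.
  by rewrite !inE big_nil/= => /eqP -> /eqP ->; rewrite !subrr normr0; lra.
rewrite -rcons_cons !mem_rcons !in_cons belast_rcons last_rcons lastI.
rewrite zip_rcons ?size_belast// big_rcons/=.
have xx : x \in x :: t by rewrite mem_head.
have ll : last x t \in x :: t by rewrite mem_last.
case/orP => [/eqP-> | zt]; case/orP => [/eqP-> | wt].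
- rewrite subrr mulr0 !addr_ge0// sumr_ge0//.
(* The induction hypothesis is used at both neighbours of [y]: the one with the larger value gives
   [ax + al - 2 * aw <= S]. *)
- have := ih _ _ xx wt; have := ih _ _ ll wt; move: (\sum_(_ <- _) _).
  move: (a x) (a y) (a (last x t)) (a w) => ax ay al aw S.
  by case: (ger0P (ay - al)); case: (ger0P (ax - ay)); case: (ger0P (ax - al)); lra.
- have := ih _ _ zt xx; have := ih _ _ zt ll; move: (\sum_(_ <- _) _).
  move: (a x) (a y) (a (last x t)) (a z) => ax ay al az S.
  by case: (ger0P (ay - al)); case: (ger0P (ax - ay)); case: (ger0P (ax - al)); lra.
- have := ih _ _ zt wt; move: (\sum_(_ <- _) _).
  move: (a x) (a y) (a (last x t)) (a z) (a w) => ax ay al az aw S.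
  by case: (ger0P (ay - al)); case: (ger0P (ax - ay)); case: (ger0P (ax - al)); lra.
Qed.

End CyclicSums.

Section CyclicVariation.
Context {R : realType}.
Implicit Types (u p q x y z l : 'rV[R]_2) (s : seq 'rV[R]_2).

(* The diagonals [x l] and [z y] of a convex quadrilateral cross, so they
   cannot be separated by a level line of a linear function. *)
Lemma convex_quad_le u x z l y (B : R) :
  0 < cross (z - x) (l - x) -> 0 < cross (z - x) (y - x) ->
  0 < cross (l - x) (y - x) -> 0 < cross (l - z) (y - z) ->
  dotp x u <= B -> dotp l u <= B -> B <= dotp y u -> dotp z u <= B.
Proof.
move=> xzl xzy xly zly xB lB By.
have E : cross (l - x) (y - x) * (B - dotp z u) =
    cross (z - x) (l - x) * (dotp y u - B) +
    cross (l - z) (y - z) * (B - dotp x u) +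
    cross (z - x) (y - x) * (B - dotp l u).
  by rewrite /cross !dotpE !mxE; lra.
rewrite -subr_ge0 -(pmulr_rge0 _ xly) E.
by apply: addr_ge0; [apply: addr_ge0|]; apply: mulr_ge0; do ?[exact: ltW]; rewrite subr_ge0.
Qed.

(** A vertex [z] strictly between [x] and [last x t] in the list forms with [x], [last x t] and [y]
    a quadrilateral as in [convex_quad_le]. *)
Lemma ccw_convex_rcons_le u x t y (B : R) z :
  ccw_convex (rcons (x :: t) y) ->
  dotp x u <= B -> dotp (last x t) u <= B -> B <= dotp y u ->
  z \in x :: t -> dotp z u <= B.
Proof.
move=> cs xB lB By /(nthP 0)[k ks <-].
case: k ks => [//|k ks].
have [kt|kt] := eqVneq k.+1 (size t); first by rewrite kt -last_nth.
have lt_kt : (k.+1 < size t)%N by rewrite ltn_neqAle kt; move: ks; rewrite /= ltnS.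
have E i : (i < (size t).+1)%N -> nth 0 (rcons (x :: t) y) i = nth 0 (x :: t) i.
  by move=> it; rewrite nth_rcons/= it.
have Ey : nth 0 (rcons (x :: t) y) (size t).+1 = y.
  by rewrite nth_rcons/= ltnn eqxx.
have sz : size (rcons (x :: t) y) = (size t).+2 by rewrite size_rcons.
have szl := last_nth 0 x t.
apply: (@convex_quad_le u x _ (last x t) y); rewrite ?szl//; last by rewrite -szl.
- by have := cs 0%N k.+1 (size t); rewrite sz !E//; apply.
- by have := cs 0%N k.+1 (size t).+1; rewrite sz Ey !E//; apply.
- by have := cs 0%N (size t) (size t).+1; rewrite sz Ey !E//; apply=> //; lia.
- by have := cs k.+1 (size t) (size t).+1; rewrite sz Ey !E//; apply.
Qed.

(** Induction on the last vertex [y]. If its value lies between those of its two neighbours,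
    inserting [y] leaves the sum unchanged. If it is beyond both, convexity keeps all other vertices
    on the far side of the level of the neighbour nearer in value; the induction hypothesis then
    holds with a smaller range, which pays for the detour to [y]. *)
Lemma ccw_convex_variation_le s u (m M : R) : ccw_convex s -> m <= M ->
  {in s, forall p, m <= dotp p u <= M} ->
  \sum_(e <- cyclic_pairs s) `|dotp e.2 u - dotp e.1 u| <= 2 * (M - m).
Proof.
elim/last_ind: s m M => [|s y ih] m M cs mM bnd.
  by rewrite big_nil mulr_ge0// subr_ge0.
case: s ih cs bnd => [|x t] ih cs bnd.
  by rewrite /cyclic_pairs/= big_seq1/= subrr normr0 mulr_ge0// subr_ge0.
have cxt := ccw_convex_rcons cs.
have bnd' : {in x :: t, forall p, m <= dotp p u <= M}.
  by move=> p ps; apply: bnd; rewrite mem_rcons in_cons ps orbT.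
have /andP[my yM] : m <= dotp y u <= M by apply: bnd; rewrite mem_rcons mem_head.
have /andP[mx xM] := bnd' x (mem_head _ _).
have /andP[ml lM] := bnd' _ (mem_last x t).
have := sum_cyclic_pairs_rcons (fun e => `|dotp e.2 u - dotp e.1 u|) x t y.
move=> /= E.
have up B : dotp x u <= B -> dotp (last x t) u <= B -> B <= dotp y u ->
    \sum_(e <- cyclic_pairs (x :: t)) `|dotp e.2 u - dotp e.1 u| <= 2 * (B - m).
  move=> xB lB By; apply: ih => //; first by lra.
  move=> p pt; have /andP[-> _] /= := bnd' _ pt.
  exact: (ccw_convex_rcons_le cs xB lB By pt).
have dn B : B <= dotp x u -> B <= dotp (last x t) u -> dotp y u <= B ->
    \sum_(e <- cyclic_pairs (x :: t)) `|dotp e.2 u - dotp e.1 u| <= 2 * (M - B).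
  move=> xB lB By; apply: ih => //; first by lra.
  move=> p pt; have /andP[_ ->] /= := bnd' _ pt.
  have := @ccw_convex_rcons_le (- u) x t y (- B) p cs.
  by rewrite !dotpNr !lerN2 andbT; apply.
have /= gen := ih m M cxt mM bnd'.
move: E (up (dotp x u)) (up (dotp (last x t) u)) (dn (dotp x u))
  (dn (dotp (last x t) u)) gen.
set S := \sum_(e <- cyclic_pairs (x :: t)) _.
set S' := \sum_(e <- _) _.
rewrite !lexx/=.
move: S S' (dotp x u) (dotp y u) (dotp (last x t) u) mx my ml xM yM lM.
clear; move=> S S' a b c ma mb mc aM bM cM E u1 u2 d1 d2 gen.
have [ba|/ltW ab] := lerP b a; have [bc|/ltW cb] := lerP b c.
- have [ac|/ltW ca] := lerP a c.
    rewrite (ler0_norm (_ : a - c <= 0)) ?(ler0_norm (_ : b - c <= 0))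
      ?(ger0_norm (_ : 0 <= a - b)) ?subr_le0 ?subr_ge0// in E.
    by move: (d1 isT ac ba) E mb; clear; lra.
  rewrite (ger0_norm (_ : 0 <= a - c)) ?(ler0_norm (_ : b - c <= 0))
    ?(ger0_norm (_ : 0 <= a - b)) ?subr_le0 ?subr_ge0// in E.
  by move: (d2 ca isT bc) E mb; clear; lra.
- rewrite (ger0_norm (_ : 0 <= a - c)) ?(ger0_norm (_ : 0 <= b - c))
    ?(ger0_norm (_ : 0 <= a - b)) ?subr_ge0 ?(le_trans cb)// in E.
  by move: gen E; clear; lra.
- rewrite (ler0_norm (_ : a - c <= 0)) ?(ler0_norm (_ : b - c <= 0))
    ?(ler0_norm (_ : a - b <= 0)) ?subr_le0 ?(le_trans ab)// in E.
  by move: gen E; clear; lra.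
- have [ac|/ltW ca] := lerP a c.
    rewrite (ler0_norm (_ : a - c <= 0)) ?(ger0_norm (_ : 0 <= b - c))
      ?(ler0_norm (_ : a - b <= 0)) ?subr_le0 ?subr_ge0// in E.
    by move: (u2 ac isT cb) E bM; clear; lra.
  rewrite (ger0_norm (_ : 0 <= a - c)) ?(ger0_norm (_ : 0 <= b - c))
    ?(ler0_norm (_ : a - b <= 0)) ?subr_le0 ?subr_ge0// in E.
  by move: (u1 isT ca ab) E bM; clear; lra.
Qed.

End CyclicVariation.

(** * Orientation of points from the order of their normals *)

Section Orientation.
Context {R : realType}.
Implicit Types (u p : 'rV[R]_2).

(** The orientation of the triangle times the cross product of two directions is a sum of products
    of differences of their values at the points. No sign is assumed for [cross u3 u1], so the three
    directions may also lie in a half-plane. *)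
Lemma support_points_ccw p1 p2 p3 u1 u2 u3 :
  0 < cross u1 u2 -> 0 < cross u2 u3 ->
  dotp p2 u1 < dotp p1 u1 -> dotp p3 u1 < dotp p1 u1 ->
  dotp p1 u2 < dotp p2 u2 -> dotp p3 u2 < dotp p2 u2 ->
  dotp p1 u3 < dotp p3 u3 -> dotp p2 u3 < dotp p3 u3 ->
  0 < cross (p2 - p1) (p3 - p1).
Proof.
move=> u12 u23 p21 p31 p12 p32 p13 p23.
have [p32u1|p32u1] := lerP (dotp p3 u1) (dotp p2 u1).
  have E : cross u1 u2 * cross (p2 - p1) (p3 - p1) =
      (dotp p1 u1 - dotp p2 u1) * (dotp p2 u2 - dotp p3 u2) +
      (dotp p2 u2 - dotp p1 u2) * (dotp p2 u1 - dotp p3 u1).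
    by rewrite /cross !dotpE !mxE; lra.
  rewrite -(pmulr_rgt0 _ u12) E ltr_pwDl ?mulr_gt0 ?subr_gt0//.
  by apply: mulr_ge0; rewrite subr_ge0 //; exact: ltW.
have [u31|u31] := ltrP 0 (cross u3 u1).
  have E : cross u3 u1 * cross (p2 - p1) (p3 - p1) =
      (dotp p3 u3 - dotp p1 u3) * (dotp p3 u1 - dotp p2 u1) +
      (dotp p1 u1 - dotp p3 u1) * (dotp p3 u3 - dotp p2 u3).
    by rewrite /cross !dotpE !mxE; lra.
  rewrite -(pmulr_rgt0 _ u31) E ltr_pwDl ?mulr_gt0 ?subr_gt0//.
  by apply: mulr_ge0; rewrite subr_ge0 //; exact: ltW.
(* The linear relation between three plane vectors, evaluated at [p3 - p2]; in the remaining case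
   its signs are contradictory. *)
have E : - cross u3 u1 * (dotp p3 u2 - dotp p2 u2) =
    cross u2 u3 * (dotp p3 u1 - dotp p2 u1) +
    cross u1 u2 * (dotp p3 u3 - dotp p2 u3).
  by rewrite /cross !dotpE; lra.
suff : 0 < - cross u3 u1 * (dotp p3 u2 - dotp p2 u2).
  rewrite ltNge => /negP[]; apply: mulr_ge0_le0; first by rewrite oppr_ge0.
  by rewrite subr_le0 ltW.
by rewrite E; apply: addr_gt0; apply: mulr_gt0 => //; rewrite subr_gt0.
Qed.

End Orientation.

(** * Regular polygons *)

Section RegularPolygon.
Context {R : realType}.
Implicit Types (a b x : R).

Definition cis a : 'rV[R]_2 := \row_j (if j == 0 then cos a else sin a).

Lemma cis0E a : cis a 0 0 = cos a. Proof. by rewrite mxE. Qed.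

Lemma cis1E a : cis a 0 1 = sin a. Proof. by rewrite mxE. Qed.

Lemma dotp_cis a b : dotp (cis a) (cis b) = cos (a - b).
Proof. by rewrite dotpE !cis0E !cis1E cosB. Qed.

Lemma cross_cis a b : cross (cis a) (cis b) = sin (b - a).
Proof. by rewrite /cross !cis0E !cis1E sinB; lra. Qed.

Lemma enorm_cis a : enorm (cis a) = 1.
Proof. by rewrite /enorm dotp_cis subrr cos0 sqrtr1. Qed.

Lemma cisDpi a : cis (a + pi) = - cis a.
Proof. by apply: eq_row2; rewrite [RHS]mxE ?cis0E ?cis1E (cosDpi, sinDpi). Qed.

(** A chord of the unit circle is orthogonal to the radius bisecting its arc; the shift by [pi / 2]
    makes the chord parallel to [cis a] itself. *)
Lemma cisB_chord a x : cis (a + x - pi / 2) - cis (a - x - pi / 2) =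
  (2 * sin x) *: cis a.
Proof.
apply: eq_row2; rewrite [LHS]mxE [X in _ + X]mxE [RHS]mxE ?cis0E ?cis1E.
- by rewrite !cosBpihalf sinB sinD; lra.
- by rewrite !sinBpihalf cosB cosD; lra.
Qed.

Lemma cos_lt1 x : 0 < x < pi *+ 2 -> cos x < 1.
Proof.
move=> /andP[x0 xpi].
have -> : x = (x / 2) *+ 2 by lra.
have s0 : 0 < sin (x / 2) by apply: sin_gt0_pi; apply/andP; split; lra.
have := exprn_gt0 2 s0; rewrite cos_mulr2n cos2sin2; lra.
Qed.

Lemma sin_le_id x : 0 <= x -> sin x <= x.
Proof.
rewrite le_eqVlt => /predU1P[<-|x0]; first by rewrite sin0.
have [y _] := @MVT R sin cos 0 x x0 (fun y _ => is_derive_sin y)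
  (continuous_subspaceT (@continuous_sin R)).
rewrite sin0 !subr0 => ->; rewrite ger_pMl//; exact: cos_le1.
Qed.

Lemma cos_ge x : 0 <= x <= pi -> 1 - x ^+ 2 / 2 <= cos x.
Proof.
move=> /andP[x0 xpi].
have -> : cos x = 1 - 2 * sin (x / 2) ^+ 2.
  have {1}-> : x = (x / 2) *+ 2 by lra.
  by rewrite cos_mulr2n cos2sin2; lra.
have s0 : 0 <= sin (x / 2) by apply: sin_ge0_pi; apply/andP; split; lra.
have sx : sin (x / 2) <= x / 2 by apply: sin_le_id; lra.
have : sin (x / 2) ^+ 2 <= (x / 2) ^+ 2 by rewrite ler_sqr// nnegrE; lra.
lra.
Qed.

Lemma sin_ge x : 0 <= x <= pi -> x - x ^+ 3 / 2 <= sin x.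
Proof.
move=> /andP[]; rewrite le_eqVlt => /predU1P[<- _|x0 xpi].
  by rewrite sin0; lra.
have [y] := @MVT R sin cos 0 x x0 (fun y _ => is_derive_sin y)
  (continuous_subspaceT (@continuous_sin R)).
rewrite in_itv/= => /andP[y0 yx]; rewrite sin0 !subr0 => ->.
have cy : 1 - y ^+ 2 / 2 <= cos y by apply: cos_ge; apply/andP; split; lra.
have yx2 : y ^+ 2 <= x ^+ 2 by rewrite ler_sqr ?nnegrE; lra.
have -> : x - x ^+ 3 / 2 = (1 - x ^+ 2 / 2) * x by lra.
by rewrite ler_pM2r//; lra.
Qed.

(** For positive [N], a regular polygon with [2N] vertices, not [N], so that shifting the index by
    [N] gives the opposite vertex. *)
Definition ngon (N : nat) (c : R) (t : nat) : 'rV[R]_2 :=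
  cis (pi * t%:R / N%:R + c).

Lemma sum_cyclic_pairs_iota (T : Type) (f : T * T -> R) (z : nat -> T) K :
  z K = z 0%N ->
  \sum_(e <- cyclic_pairs [seq z t | t <- iota 0 K]) f e =
  \sum_(t <- iota 0 K) f (z t, z t.+1).
Proof.
case: K => [|K] zK; first by rewrite !big_nil.
have -> : cyclic_pairs [seq z t | t <- iota 0 K.+1] =
    [seq (z t, z t.+1) | t <- iota 0 K.+1].
  rewrite -zip_map /cyclic_pairs; congr zip.
  rewrite [map z _]/= rot1_cons -zK -map_rcons.
  by rewrite -[rcons _ _]cats1 -[[:: K.+1]]/(iota (1 + K) 1) -iotaD addn1 (iotaDl 1 0) -map_comp.
by rewrite big_map.
Qed.

Lemma ngon_double N c t : (0 < N)%N -> ngon N c (t + N) = - ngon N c t.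
Proof.
move=> N0; rewrite /ngon -cisDpi natrD; congr cis.
have : N%:R != 0 :> R by rewrite pnatr_eq0 -lt0n.
by move=> NN; rewrite mulrDr mulrDl mulfK// addrAC.
Qed.

Lemma ngon_cross N c i j : (i < j < i + N)%N -> 0 < cross (ngon N c i) (ngon N c j).
Proof.
move=> /andP[ij jN]; have N1 : (0 < N)%N by lia.
have N0 : 0 < N%:R :> R by rewrite ltr0n.
rewrite /ngon cross_cis.
have -> : pi * j%:R / N%:R + c - (pi * i%:R / N%:R + c) =
    pi * (j - i)%:R / N%:R :> R.
  by rewrite opprD addrACA subrr addr0 -mulrBl -mulrBr natrB// ltnW.
apply: sin_gt0_pi; rewrite divr_gt0 ?mulr_gt0 ?pi_gt0 ?ltr0n ?subn_gt0//=.
rewrite ltr_pdivrMr// ltr_pM2l ?pi_gt0// ltr_nat; lia.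
Qed.

Lemma ngon_dotp_lt1 N c i j : i != j -> (i < N + N)%N -> (j < N + N)%N ->
  dotp (ngon N c i) (ngon N c j) < 1.
Proof.
wlog ij : i j / (i < j)%N.
  move=> H ij iN jN; have [lt_ij|lt_ji|eq_ij] := ltngtP i j; first exact: H.
    by rewrite dotpC; apply: H; rewrite // eq_sym.
  by rewrite eq_ij eqxx in ij.
move=> _ _ jN; have N1 : (0 < N)%N by lia.
have N0 : 0 < N%:R :> R by rewrite ltr0n.
rewrite dotpC /ngon dotp_cis.
have -> : pi * j%:R / N%:R + c - (pi * i%:R / N%:R + c) =
    pi * (j - i)%:R / N%:R :> R.
  by rewrite opprD addrACA subrr addr0 -mulrBl -mulrBr natrB// ltnW.
apply: cos_lt1; rewrite divr_gt0 ?mulr_gt0 ?pi_gt0 ?ltr0n ?subn_gt0//=.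
rewrite ltr_pdivrMr// -(mulr_natr pi 2) -mulrA ltr_pM2l ?pi_gt0//.
rewrite -natrM ltr_nat; lia.
Qed.

Lemma ngon_support_ccw N c (p : nat -> 'rV[R]_2) :
  (forall i j, i != j -> (i < N + N)%N -> (j < N + N)%N ->
    dotp (p i) (ngon N c j) < dotp (p j) (ngon N c j)) ->
  ccw_convex [seq p t | t <- iota 0 (N + N)].
Proof.
move=> psup i j k ij jk; rewrite size_map size_iota => kN.
have E t : (t < N + N)%N -> [seq p t | t <- iota 0 (N + N)]`_t = p t.
  by move=> tN; rewrite (nth_map 0%N) ?size_iota// nth_iota.
rewrite !E ?(ltn_trans jk)// ?(ltn_trans ij (ltn_trans jk _))//.
have iN := ltn_trans ij (ltn_trans jk kN); have jN := ltn_trans jk kN.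
have N0 : (0 < N)%N by lia.
have wrap : (i + N < k)%N -> 0 < cross (ngon N c k) (ngon N c i).
  move=> ik; have -> : ngon N c i = ngon N c (i + N + N).
    by rewrite !ngon_double// opprK.
  by apply: ngon_cross; lia.
(* At most one cyclic gap between the three directions reaches a half turn; the triple is rotated to
   put this gap between the third direction and the first. *)
have [jiN|jiN] := ltnP j (i + N); last first.
  rewrite (_ : cross _ _ = cross (p k - p j) (p i - p j)); last first.
    by rewrite /cross !mxE; lra.
  apply: (@support_points_ccw _ _ _ _ (ngon N c j) (ngon N c k) (ngon N c i));
    by [apply: ngon_cross; lia | apply: wrap; lia | apply: psup; lia].
have [kjN|kjN] := ltnP k (j + N); last first.
  rewrite (_ : cross _ _ = cross (p i - p k) (p j - p k)); last first.
    by rewrite /cross !mxE; lra.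
  apply: (@support_points_ccw _ _ _ _ (ngon N c k) (ngon N c i) (ngon N c j));
    by [apply: ngon_cross; lia | apply: wrap; lia | apply: psup; lia].
apply: (@support_points_ccw _ _ _ _ (ngon N c i) (ngon N c j) (ngon N c k));
  by [apply: ngon_cross; lia | apply: psup; lia].
Qed.
End RegularPolygon.

(** * The discrete Crofton formula *)

Section Crofton.
Context {R : realType}.
Implicit Types (N : nat) (c : R) (e u : 'rV[R]_2).

Lemma crossNl u v : cross (- u) v = - cross u v.
Proof. by rewrite /cross !mxE; lra. Qed.

Lemma crossNr u v : cross u (- v) = - cross u v.
Proof. by rewrite /cross !mxE; lra. Qed.

Lemma dotp_ngon N c t : dotp (ngon N c t) (ngon N c t) = 1.
Proof. by rewrite dotp_cis subrr cos0. Qed.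

Lemma ngon_ccw_convex N c : ccw_convex [seq ngon N c t | t <- iota 0 (N + N)].
Proof.
apply: (@ngon_support_ccw _ N c (ngon N c)) => i j ij iN jN.
by rewrite /= dotp_ngon ngon_dotp_lt1.
Qed.

Lemma ngon_opp N c t : (0 < N)%N -> (t < N + N)%N ->
  exists2 r, (r < N + N)%N & ngon N c r = - ngon N c t.
Proof.
move=> N0 tN; have [lt_tN|le_Nt] := ltnP t N.
  by exists (t + N)%N; [lia | rewrite ngon_double].
exists (t - N)%N; first lia.
by rewrite -{2}(subnK le_Nt) ngon_double// opprK.
Qed.

Lemma ngon_half N c : (0 < N)%N -> ngon N c N = - ngon N c 0.
Proof. exact: (@ngon_double R N c 0). Qed.

(** Up to the sign of [e], two consecutive vertices [z] and [w] enclose [e] in their cone. There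
    [dotp z e + dotp w e] is large, and the better of the two is paired with its opposite vertex. *)
Lemma ngon_width N c e : (1 < N)%N -> exists i j,
  [/\ (i < N + N)%N, (j < N + N)%N &
   (1 + cos (pi / N%:R)) * enorm e <= dotp (ngon N c i) e - dotp (ngon N c j) e].
Proof.
move=> N1; have N0 : (0 < N)%N by lia.
wlog f0 : e / 0 <= cross (ngon N c 0) e.
  move=> H; have [/H//|f0] := lerP 0 (cross (ngon N c 0) e).
  have [|j [i [jN iN le_ij]]] := H (- e).
    by rewrite crossNr oppr_ge0 ltW.
  exists i, j; split=> //; move: le_ij.
  have -> : enorm (- e) = enorm e by rewrite /enorm !dotpE !mxE !mulrNN.
  by rewrite !dotpNr opprK [- _ + _]addrC.
pose f t := cross (ngon N c t) e.
have fN : f N = - f 0%N.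
  by rewrite /f ngon_half// crossNl.
(* A discrete intermediate value argument: [f N = - f 0] forces a sign change, and the first one is
   taken. *)
have exP : exists t, f t.+1 <= 0.
  by exists N.-1; rewrite prednK// fN oppr_le0.
have mN : (ex_minn exP <= N.-1)%N.
  by case: ex_minnP => m _; apply; rewrite prednK// fN oppr_le0.
move: mN; case: ex_minnP => m fm1 min_m mN.
have fm : 0 <= f m.
  case: m fm1 min_m mN => [//|m] _ min_m _; rewrite leNgt; apply/negP => fm.
  by have := min_m m (ltW fm); rewrite ltnn.
have S0 : 0 < cross (ngon N c m) (ngon N c m.+1) by apply: ngon_cross; lia.
have C1 : dotp (ngon N c m) (ngon N c m.+1) = cos (pi / N%:R).
  rewrite dotpC dotp_cis; congr cos.
  by rewrite opprD addrACA subrr addr0 -mulrBl -mulrBr -natr1 addrAC subrr add0r mulr1.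
have := dotp_ngon N c m; have := dotp_ngon N c m.+1.
have C2 := cos_le1 (pi / N%:R : R).
move: fm fm1 S0 C1 C2; rewrite /f.
suff main z w : dotp z z = 1 -> dotp w w = 1 -> dotp z w <= 1 -> 0 < cross z w ->
    0 <= cross z e -> cross w e <= 0 ->
    (1 + dotp z w) * enorm e <= dotp z e + dotp w e.
  move=> fm fm1 S0 C1 C2 ww zz.
  have := main _ _ zz ww; rewrite C1 => /(_ C2 S0 fm fm1) le_sum.
  have [le_mm1|lt_m1m] := lerP (dotp (ngon N c m) e) (dotp (ngon N c m.+1) e).
    have [|r rN Er] := @ngon_opp N c m.+1 N0; first lia.
    exists m.+1, r; split=> //; first lia.
    by rewrite Er [dotp (- _) _]dotpC dotpNr [dotp e _]dotpC; lra.
  have [|r rN Er] := @ngon_opp N c m N0; first lia.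
  exists m, r; split=> //; first lia.
  by rewrite Er [dotp (- _) _]dotpC dotpNr [dotp e _]dotpC; lra.
move=> {}zz ww zw S0 fz fw.
(* By Cramer's rule [cross z w *: e = a *: z + b *: w]. Pairing with [z + w] gives [Se], and taking
   norms gives [Sab]. *)
pose a := - cross w e; pose b := cross z e.
have a0 : 0 <= a by rewrite oppr_ge0.
have Se : cross z w * (dotp z e + dotp w e) = (a + b) * (1 + dotp z w).
  have -> : cross z w * (dotp z e + dotp w e) =
     a * dotp z z + a * dotp z w + b * dotp z w + b * dotp w w.
    by rewrite /a /b /cross !dotpE; lra.
  by rewrite zz ww; lra.
have Sab : cross z w * enorm e <= a + b.
  rewrite -ler_sqr; last 2 first.
  - by rewrite nnegrE; apply: mulr_ge0; [exact: ltW | exact: enorm_ge0].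
  - by rewrite nnegrE; apply: addr_ge0.
  rewrite exprMn enorm_sqr.
  have -> : cross z w ^+ 2 * dotp e e =
     a ^+ 2 * dotp z z + 2 * (a * b) * dotp z w + b ^+ 2 * dotp w w.
    by rewrite /a /b /cross !dotpE; lra.
  have := mulr_ge0 a0 fz; rewrite -/b => ab0.
  have : a * b * dotp z w <= a * b * 1 by rewrite ler_wpM2l.
  by rewrite zz ww; lra.
have zw1 : 0 <= 1 + dotp z w.
  by have := cauchy_schwarz z w; rewrite /enorm zz ww sqrtr1 mulr1 ler_norml; lra.
rewrite -(ler_pM2l S0) Se mulrCA [leRHS]mulrC.
by rewrite ler_wpM2l.
Qed.

(** This rotation [c] makes edge [t] of the [2N]-gon parallel to the direction [ngon N 0 t], so a
    sum over directions becomes a sum over edges. *)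
Lemma ngon_edge N t : (0 < N)%N ->
  let c := - (pi / (2 * N%:R)) - pi / 2 in
  ngon N c t.+1 - ngon N c t = (2 * sin (pi / (2 * N%:R))) *: ngon N 0 t :> 'rV[R]_2.
Proof.
move=> N0 c; rewrite -cisB_chord addr0; congr (cis _ - cis _); last first.
  by rewrite addrA.
rewrite /c addrA; congr (_ - _); rewrite -natr1 mulrDr mulr1 mulrDl -addrA.
congr (_ + _); rewrite invfM; lra.
Qed.

Lemma crofton_variation N e : (0 < N)%N ->
  let c := - (pi / (2 * N%:R)) - pi / 2 in
  2 * sin (pi / (2 * N%:R)) * \sum_(t <- iota 0 (N + N)) `|dotp e (ngon N 0 t)| =
  \sum_(d <- cyclic_pairs [seq ngon N c t | t <- iota 0 (N + N)])
    `|dotp d.2 e - dotp d.1 e|.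
Proof.
move=> N0 c; rewrite sum_cyclic_pairs_iota; last first.
  by rewrite ngon_double// ngon_half// opprK.
rewrite mulr_sumr; apply: eq_bigr => t _ /=.
rewrite -dotpBl ngon_edge// dotpZl normrM dotpC ger0_norm//.
rewrite mulr_ge0// sin_ge0_pi// divr_ge0 ?pi_ge0 ?mulr_ge0//=.
rewrite ler_pdivrMr ?mulr_gt0 ?ltr0n// ler_peMr ?pi_ge0//.
by rewrite -natrM ler1n muln_gt0.
Qed.

(** The vertices of the [2N]-gon are unit vectors, so the variation around it is at most twice the
    range from [- enorm e] to [enorm e]. The lower bound [crofton_ge] has [1 + cos (pi / N%:R)],
    which tends to [2], in place of [2]. *)
Lemma crofton_le N e : (0 < N)%N ->
  sin (pi / (2 * N%:R)) * \sum_(t <- iota 0 (N + N)) `|dotp e (ngon N 0 t)| <=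
  2 * enorm e.
Proof.
move=> N0; rewrite -(@ler_pM2l _ 2)// mulrA crofton_variation//.
set c := _ - _; have -> : 2 * (2 * enorm e) = 2 * (enorm e - - enorm e) by lra.
apply: ccw_convex_variation_le; first exact: ngon_ccw_convex.
  by have := enorm_ge0 e; lra.
move=> p /mapP[t _ ->]; rewrite -ler_norml.
by rewrite (le_trans (cauchy_schwarz _ _))// enorm_cis mul1r.
Qed.

Lemma crofton_ge N e : (1 < N)%N ->
  (1 + cos (pi / N%:R)) * enorm e <=
  sin (pi / (2 * N%:R)) * \sum_(t <- iota 0 (N + N)) `|dotp e (ngon N 0 t)|.
Proof.
move=> N1; have N0 : (0 < N)%N by lia.
rewrite -(@ler_pM2l _ 2)// [leRHS]mulrA crofton_variation//.
set c := _ - _; have [i [j [iN jN le_ij]]] := @ngon_width N c e N1.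
have mem t : (t < N + N)%N -> ngon N c t \in [seq ngon N c t | t <- iota 0 (N + N)].
  by move=> tN; rewrite map_f// mem_iota.
apply: le_trans (variation_ge_diff (fun p => dotp p e) (mem _ iN) (mem _ jN)).
by rewrite ler_pM2l.
Qed.

End Crofton.

(** * Steiner's formula *)

Section Steiner.
Context {R : realType}.
Implicit Types (K : set 'rV[R]_2) (P Q : seq 'rV[R]_2) (p q u : 'rV[R]_2).

Lemma dotp_continuous u : continuous (fun q => dotp q u).
Proof.
have -> : (fun q => dotp q u) = (fun q => q 0 0) \* cst (u 0 0) + (fun q => q 0 1) \* cst (u 0 1).
  by apply/funext => y; rewrite dotpE.
by move=> x; apply: continuousD; apply: continuousM; do ?[exact: coord_continuous];
  exact: cst_continuous.
Qed.

Lemma le_halfspace_closure K u (h : R) :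
  (forall q, K q -> dotp q u <= h) -> forall q, closure K q -> dotp q u <= h.
Proof.
move=> Kh q; have cl : closed [set q | dotp q u <= h].
  apply: (@preimage_closed _ _ (fun q => dotp q u) [set x | x <= h]); last exact: closed_le.
  by move=> x _; exact: dotp_continuous.
by move=> /(closure_subset (Kh : K `<=` [set q | dotp q u <= h])); rewrite -(closure_id _).1.
Qed.

Lemma le_of_le_inv_nat (a b k : R) :
  (forall N, (1 < N)%N -> a <= b + k / N%:R) -> a <= b.
Proof.
move=> H; apply/ler_addgt0Pr => e e0.
have k0 : 0 < `|k| + 1 by rewrite ltr_pwDr.
pose N := (Num.truncn ((`|k| + 1) / e)).+2.
apply: le_trans (H N isT) _; rewrite lerD2l ler_pdivrMr ?ltr0n//.
have : (`|k| + 1) / e < N%:R.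
  by apply: lt_le_trans (truncnS_gt _) _; rewrite ler_nat.
rewrite ltr_pdivrMr// mulrC => /ltW; apply: le_trans.
by apply: le_trans (ler_norm k) _; lra.
Qed.

(** The weight of one direction times the number [2N] of directions; this turns the excess [2] of
    every width into the term [2 * pi]. The [8] is crude and comes from [pi <= 4]. *)
Lemma sin_crofton_bounds N : (1 < N)%N ->
  (pi : R) - 8 / N%:R <= 2 * N%:R * sin (pi / (2 * N%:R)) <= (pi : R).
Proof.
move=> N1; have N0 : 0 < N%:R :> R by rewrite ltr0n; lia.
have N2 : 2 <= N%:R :> R by rewrite (ler_nat _ 2).
set x := pi / _.
have Nx : 2 * N%:R * x = pi by rewrite mulrC divfK// mulf_neq0// gt_eqF.
have p0 := pi_gt0 R; have p4 : pi <= 4 :> R.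
  by have := pihalf_lt2 R; lra.
have x0 : 0 <= x by rewrite divr_ge0 ?ltW// mulr_gt0.
have xpi : x <= pi.
  by rewrite -[leRHS]Nx; apply: ler_peMl => //; lra.
have xN : x <= 2 / N%:R.
  by rewrite ler_pdivlMr//; lra.
have x1 : x <= 1 by apply: le_trans xN _; rewrite ler_pdivrMr//; lra.
apply/andP; split; last first.
  rewrite -[leRHS]Nx ler_pM2l ?mulr_gt0//; exact: sin_le_id.
have : x - x ^+ 3 / 2 <= sin x by apply: sin_ge; rewrite x0.
rewrite -(ler_pM2l (_ : 0 < 2 * N%:R)) ?mulr_gt0// mulrBr Nx.
apply: le_trans; rewrite lerD2l lerN2.
have -> : 2 * N%:R * (x ^+ 3 / 2) = 2 * N%:R * x * (x / 2) * x by lra.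
rewrite Nx.
have : pi * (x / 2) * x <= 4 * 1 * x.
  by rewrite ler_wpM2r// ler_pM//; lra.
move=> /le_trans; apply; lra.
Qed.

Lemma cos_crofton_ge N : (1 < N)%N -> 1 - 8 / N%:R <= cos (pi / N%:R) :> R.
Proof.
move=> N1; have N0 : 0 < N%:R :> R by rewrite ltr0n; lia.
have N2 : 2 <= N%:R :> R by rewrite (ler_nat _ 2).
set x := pi / _.
have p0 := pi_gt0 R; have p4 : pi <= 4 :> R.
  by have := pihalf_lt2 R; lra.
have x0 : 0 <= x by rewrite divr_ge0 ?ltW.
have xpi : x <= pi by rewrite ler_pdivrMr// ler_peMr ?ltW//; lra.
have xN : x <= 4 / N%:R by rewrite ler_pM2r ?invr_gt0.
have x4 : x <= 4 by lra.
have : 1 - x ^+ 2 / 2 <= cos x by apply: cos_ge; rewrite x0.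
apply: le_trans; rewrite lerD2l lerN2.
have : x * x <= 4 * x by rewrite ler_wpM2r.
by rewrite expr2; lra.
Qed.

(** Interchanging the sums leaves, for each direction, the variation around the polygon. *)
Lemma sum_width N P (W : nat -> R) :
  (forall t, (t < N + N)%N ->
    \sum_(e <- cyclic_pairs P) `|dotp e.2 (ngon N 0 t) - dotp e.1 (ngon N 0 t)| = W t) ->
  \sum_(e <- cyclic_pairs P) \sum_(t <- iota 0 (N + N)) `|dotp (e.2 - e.1) (ngon N 0 t)| =
  \sum_(t <- iota 0 (N + N)) W t.
Proof.
move=> PW; rewrite exchange_big; apply: eq_big_seq => t.
rewrite mem_iota => tN; rewrite -PW//.
by apply: eq_bigr => e _; rewrite dotpBl.
Qed.

Lemma crofton_polygon_le N P : (0 < N)%N ->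
  sin (pi / (2 * N%:R)) *
    \sum_(e <- cyclic_pairs P) \sum_(t <- iota 0 (N + N)) `|dotp (e.2 - e.1) (ngon N 0 t)|
  <= 2 * polygon_length P.
Proof. by move=> N0; rewrite !mulr_sumr ler_sum// => e _; exact: crofton_le. Qed.

Lemma crofton_polygon_ge N P : (1 < N)%N ->
  (1 + cos (pi / N%:R)) * polygon_length P <=
  sin (pi / (2 * N%:R)) *
    \sum_(e <- cyclic_pairs P) \sum_(t <- iota 0 (N + N)) `|dotp (e.2 - e.1) (ngon N 0 t)|.
Proof. by move=> N0; rewrite !mulr_sumr ler_sum// => e _; exact: crofton_ge. Qed.

Lemma polygon_length_ge0 P : 0 <= polygon_length P.
Proof. by rewrite sumr_ge0// => e _; exact: enorm_ge0. Qed.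

(** * Boundary length of a parallel body *)

Section ParallelBody.
Variables (K : set 'rV[R]_2) (P : seq 'rV[R]_2).
Hypothesis ccwP : ccw_convex P.
(** The specification stands in for [K] being the parallel body of [P] at distance one: [K] stays
    within one unit of each support line of [P], and its frontier attains this bound at
    [support u + u]. *)
Variable support : 'rV[R]_2 -> 'rV[R]_2.
Hypothesis support_spec : forall u, enorm u = 1 ->
  [/\ support u \in P, forall q, q \in P -> dotp q u <= dotp (support u) u,
      forall q, K q -> dotp q u <= dotp (support u) u + 1
    & frontier K (support u + u)].

Let width u := dotp (support u) u + dotp (support (- u)) (- u).

Let enormN u : enorm (- u) = enorm u.
Proof. by rewrite /enorm !dotpE !mxE !mulrNN. Qed.

Let variation_width u : enorm u = 1 ->
  \sum_(e <- cyclic_pairs P) `|dotp e.2 u - dotp e.1 u| = 2 * width u.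
Proof.
move=> u1; have u1' : enorm (- u) = 1 by rewrite enormN.
have [sP smax _ _] := support_spec u1; have [sP' smax' _ _] := support_spec u1'.
have -> : width u = dotp (support u) u - dotp (support (- u)) u.
  by rewrite /width [dotp (support (- u)) (- u)]dotpNr.
apply: le_anti; apply/andP; split.
  apply: ccw_convex_variation_le => //; first exact: smax.
  move=> p pP; rewrite smax// andbT.
  by have := smax' _ pP; rewrite !dotpNr lerN2.
exact: (variation_ge_diff (fun p => dotp p u) sP sP').
Qed.

Let inscribed Q := {in Q, forall p, frontier K p} /\ ccw_convex Q.

Let inscribed_variation_le Q u : inscribed Q -> enorm u = 1 ->
  \sum_(e <- cyclic_pairs Q) `|dotp e.2 u - dotp e.1 u| <= 2 * (width u + 2).
Proof.
move=> [QK ccwQ] u1; have u1' : enorm (- u) = 1 by rewrite enormN.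
have [sP smax sK _] := support_spec u1; have [sP' smax' sK' _] := support_spec u1'.
have -> : width u + 2 =
    (dotp (support u) u + 1) - (dotp (support (- u)) u - 1).
  by rewrite /width [dotp (support (- u)) (- u)]dotpNr; lra.
apply: ccw_convex_variation_le => //.
  by have := smax _ sP'; lra.
move=> p /QK[pK _]; rewrite (le_halfspace_closure sK pK) andbT.
have := le_halfspace_closure sK' pK; rewrite !dotpNr; lra.
Qed.

Let polygon N := [seq support (ngon N 0 t) + ngon N 0 t | t <- iota 0 (N + N)].

(** Several directions may share one support vertex of [P]; the added unit normals make each maximum
    strict, as [ngon_support_ccw] requires. *)
Let polygon_inscribed N : inscribed (polygon N).
Proof.
split=> [p /mapP[t _ ->]|].
  by have [] := support_spec (enorm_cis (pi * t%:R / N%:R + 0)).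
apply: (@ngon_support_ccw _ N 0) => i j ij iN jN.
rewrite !dotpDl dotp_ngon.
have [siP _ _ _] := support_spec (enorm_cis (pi * i%:R / N%:R + 0)).
have [_ sjmax _ _] := support_spec (enorm_cis (pi * j%:R / N%:R + 0)).
by apply: ler_ltD; [exact: sjmax | exact: ngon_dotp_lt1].
Qed.

(** The vertices for two opposite directions realise the width of [P] plus one unit on each side. *)
Let polygon_variation_ge N t : (0 < N)%N -> (t < N + N)%N ->
  2 * (width (ngon N 0 t) + 2) <=
  \sum_(e <- cyclic_pairs (polygon N))
    `|dotp e.2 (ngon N 0 t) - dotp e.1 (ngon N 0 t)|.
Proof.
move=> N0 tN; have [r rN Er] := @ngon_opp R N 0 t N0 tN.
have mem k : (k < N + N)%N -> support (ngon N 0 k) + ngon N 0 k \in polygon N.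
  by move=> kN; apply/mapP; exists k; rewrite ?mem_iota.
apply: le_trans (variation_ge_diff (fun p => dotp p (ngon N 0 t)) (mem _ tN) (mem _ rN)).
rewrite ler_pM2l// !dotpDl Er /width !dotpNr [dotp (- _) _]dotpC dotpNr dotp_ngon.
lra.
Qed.

Let sum_const N (k : R) : \sum_(t <- iota 0 (N + N)) k = 2 * N%:R * k.
Proof.
rewrite big_const_seq count_predT size_iota iter_addr addr0 -(mulr_natr k).
by rewrite natrD; lra.
Qed.

Let sumP N : (0 < N)%N ->
  \sum_(e <- cyclic_pairs P) \sum_(t <- iota 0 (N + N)) `|dotp (e.2 - e.1) (ngon N 0 t)| =
  \sum_(t <- iota 0 (N + N)) 2 * width (ngon N 0 t).
Proof. by move=> N0; apply: sum_width => t tN; exact/variation_width/enorm_cis. Qed.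

Let sin_ge0 N : 0 <= sin (pi / (2 * N%:R)) :> R.
Proof.
case: N => [|N]; first by rewrite mulr0 invr0 mulr0 sin0.
apply: sin_ge0_pi; rewrite divr_ge0 ?pi_ge0//= ler_pdivrMr// ler_peMr ?pi_ge0//.
by rewrite -natrM ler1n.
Qed.

(** The lower Crofton bound for [Q] meets the upper one for [P] through the widths. The error
    [8 / N%:R] of the cosine, halved, costs [4 * polygon_length Q / N%:R], and [Q] is fixed as [N]
    grows. *)
Let length_le Q : inscribed Q -> polygon_length Q <= polygon_length P + 2 * pi.
Proof.
move=> insQ; apply: (@le_of_le_inv_nat _ _ (4 * polygon_length Q)) => N N1.
have N0 : (0 < N)%N by lia.
have := crofton_polygon_ge Q N1; rewrite (sum_width (fun t _ => erefl)).
have : \sum_(t <- iota 0 (N + N))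
    \sum_(e <- cyclic_pairs Q) `|dotp e.2 (ngon N 0 t) - dotp e.1 (ngon N 0 t)| <=
    \sum_(t <- iota 0 (N + N)) 2 * width (ngon N 0 t) + 2 * N%:R * 4.
  rewrite -sum_const -big_split/= ler_sum// => t _.
  by apply: le_trans (inscribed_variation_le insQ (enorm_cis _)) _; lra.
move=> /(ler_wpM2l (sin_ge0 N)) le1 /le_trans/(_ le1).
have := crofton_polygon_le P N0; rewrite sumP// mulrDr => leP.
have /andP[_ sinN] := sin_crofton_bounds N1.
have := ler_wpM2r (polygon_length_ge0 Q) (cos_crofton_ge N1).
move: (polygon_length_ge0 Q) leP sinN.
move: (polygon_length Q) (polygon_length P) (sin _) (cos _) => l l' s k.
rewrite mulrBl -[8 / _ * l]mulrAC.
move: (\sum_(_ <- _) _) (N%:R) => S M; move: (M^-1) => M'; lra.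
Qed.

Let length_ge N : (1 < N)%N ->
  polygon_length P + 2 * pi <= polygon_length (polygon N) +
    (4 * polygon_length P + 16) / N%:R.
Proof.
move=> N1; have N0 : (0 < N)%N by lia.
have := crofton_polygon_le (polygon N) N0; rewrite (sum_width (fun t _ => erefl)).
have : \sum_(t <- iota 0 (N + N)) 2 * width (ngon N 0 t) + 2 * N%:R * 4 <=
    \sum_(t <- iota 0 (N + N)) \sum_(e <- cyclic_pairs (polygon N))
      `|dotp e.2 (ngon N 0 t) - dotp e.1 (ngon N 0 t)|.
  rewrite -sum_const -big_split/= !big_seq ler_sum// => t.
  rewrite mem_iota => tN; apply: le_trans (polygon_variation_ge N0 tN); lra.
move=> /(ler_wpM2l (sin_ge0 N)) le1 /(le_trans le1) {le1}.
have := crofton_polygon_ge P N1; rewrite sumP// mulrDr => leP.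
have /andP[sinN _] := sin_crofton_bounds N1.
have := ler_wpM2r (polygon_length_ge0 P) (cos_crofton_ge N1).
move: leP sinN.
move: (polygon_length P) (polygon_length _) (sin _) (cos _) => l l' s k.
rewrite mulrBl.
move: (\sum_(_ <- _) _) (N%:R) => S M; move: (M^-1) => M'; lra.
Qed.

Lemma boundary_length_parallel_body :
  boundary_length K = polygon_length P + 2 * pi.
Proof.
rewrite /boundary_length; set S := [set _ | _ in _].
have ubS : ubound S (polygon_length P + 2 * pi).
  by move=> _ [Q insQ <-]; exact: length_le.
apply/eqP; rewrite eq_le; apply/andP; split.
  (* The empty polygon [polygon 0] witnesses that the set is nonempty. *)
  by apply: ge_sup => //; exists (polygon_length (polygon 0)), (polygon 0).
apply: (@le_of_le_inv_nat _ _ (4 * polygon_length P + 16)) => N N1.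
apply: le_trans (length_ge N1) _; rewrite lerD2r.
apply: ub_le_sup; first by exists (polygon_length P + 2 * pi).
by exists (polygon N); first exact: polygon_inscribed.
Qed.

End ParallelBody.
End Steiner.

(** * The hull of the disks *)

Lemma cyclic_pairs_map (T U : Type) (f : T -> U) (s : seq T) :
  cyclic_pairs [seq f x | x <- s] = [seq (f e.1, f e.2) | e <- cyclic_pairs s].
Proof.
rewrite /cyclic_pairs -map_rot.
by elim: s (rot 1 s) => [|x s ih] [|y t] //=; rewrite ih.
Qed.

Section DiskHull.
Context {R : realType}.

Lemma convex_halfspace (u : 'rV[R]_2) (h : R) : convex_set [set x | dotp x u <= h].
Proof.
move=> x y l; rewrite !inE/= => xh yh.
rewrite [X in dotp X]/(_ *: _ + _ *: _) dotpDl !dotpZl.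
have l0 : 0 <= l%:num by []; have l1 : l%:num <= 1 by [].
apply: (@le_trans _ _ (l%:num * h + (1 - l%:num) * h)); last by lra.
by apply: lerD; rewrite ler_wpM2l// subr_ge0.
Qed.

(* Lexicographic half-planes: unlike closed ones they isolate one extreme point. *)
Lemma convex_lex_halfspace (u : 'rV[R]_2) (h k : R) :
  convex_set [set x | dotp x u < h \/ dotp x u = h /\ cross u x <= k].
Proof.
apply/convex_setW => x y; rewrite !inE/= => xH yH l l0 l1; rewrite inE/=.
rewrite ![conv _ _ _]/(_ *: _ + _ *: _) dotpDl !dotpZl.
have -> a b : cross u (a *: x + b *: y) = a * cross u x + b * cross u y.
  by rewrite /cross !mxE; lra.
rewrite /unstable.onem; set a := l%:num in l0 l1 *.
have l1' : 0 < 1 - a by rewrite subr_gt0.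
have lt_avg p q : p <= h -> q <= h -> p < h \/ q < h -> a * p + (1 - a) * q < h.
  move=> ph qh pq; have -> : h = a * h + (1 - a) * h by lra.
  by case: pq => [pq|pq]; [apply: ltr_leD | apply: ler_ltD];
    rewrite ?ltr_pM2l ?ler_pM2l.
case: xH => [xh|[xh xk]]; case: yH => [yh|[yh yk]].
- by left; apply: lt_avg; [exact: ltW | exact: ltW | left].
- by left; apply: lt_avg; [exact: ltW | rewrite yh | left].
- by left; apply: lt_avg; [rewrite xh | exact: ltW | right].
- right; rewrite xh yh; split; first lra.
  apply: (@le_trans _ _ (a * k + (1 - a) * k)); last by lra.
  by apply: lerD; rewrite ler_pM2l.
Qed.

(** [dotp x u] and [cross u x] are the coordinates of [x] in the orthonormal frame formed by [u] and
    its quarter turn. *)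
Lemma eq_dotp_cross (u x y : 'rV[R]_2) : enorm u = 1 ->
  dotp x u = dotp y u -> cross u x = cross u y -> x = y.
Proof.
move=> u1; have uu : dotp u u = 1 by rewrite -enorm_sqr u1 expr1n.
have frame (z : 'rV[R]_2) :
    z 0 0 * dotp u u = dotp z u * u 0 0 - cross u z * u 0 1 /\
    z 0 1 * dotp u u = dotp z u * u 0 1 + cross u z * u 0 0.
  by rewrite /cross !dotpE; split; lra.
have [x0 x1] := frame x; have [y0 y1] := frame y.
move=> xy1 xy2; rewrite uu !mulr1 in x0 x1 y0 y1.
by apply: eq_row2; rewrite ?x0 ?x1 xy1 xy2 ?y0 ?y1.
Qed.

Variable n : nat.
Implicit Types (d : 'M[R]_(n, 2)) (u : 'rV[R]_2).

(** A farthest centre may lie inside a hull edge orthogonal to [u]. Ties are broken by maximising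
    [cross u], and the lexicographic half-plane then certifies an extreme point. *)
Lemma hull_vertex_farthest d u : (0 < n)%N -> enorm u = 1 ->
  exists2 i, hull_vertex d i & forall j, dotp (row j d) u <= dotp (row i d) u.
Proof.
move=> n0 u1; pose i0 : 'I_n := Ordinal n0.
pose i1 := [arg max_(i > i0) dotp (row i d) u]%O.
have max1 j : dotp (row j d) u <= dotp (row i1 d) u.
  by rewrite /i1; case: arg_maxP => // i _ /(_ j); apply.
pose h := dotp (row i1 d) u.
pose i2 := [arg max_(i > i1 | dotp (row i d) u == h) cross u (row i d)]%O.
have [E2 max2] : dotp (row i2 d) u = h /\
    forall j, dotp (row j d) u = h -> cross u (row j d) <= cross u (row i2 d).
  rewrite /i2; case: arg_maxP => [|i /eqP ih maxi]; first exact: eqxx.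
  by split=> // j /eqP jh; exact: maxi.
exists i2; last by move=> j; rewrite E2.
set k := cross u (row i2 d) in max2.
have hullH x : centre_hull d x -> dotp x u < h \/ dotp x u = h /\ cross u x <= k.
  apply: (smallest_sub (@convex_lex_halfspace u h k)) => _ [j _ <-] /=.
  have := max1 j; rewrite le_eqVlt => /predU1P[jh|]; last by left.
  by right; split=> //; exact: max2.
split; first by apply: sub_gen_smallest; exists i2.
move=> p q t /hullH pH /hullH qH /andP[t0 t1] E.
have t1' : 0 < 1 - t by rewrite subr_gt0.
have Ed : h = t * dotp p u + (1 - t) * dotp q u by rewrite -E2 E dotpDl !dotpZl.
have Ec : k = t * cross u p + (1 - t) * cross u q.
  by rewrite /k E /cross !mxE; lra.
have squeeze (a b m : R) : a <= m -> b <= m -> m = t * a + (1 - t) * b -> a = m /\ b = m.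
  move=> am bm Em.
  have ta : 0 <= t * (m - a) by rewrite mulr_ge0 ?subr_ge0// ltW.
  have tb : 0 <= (1 - t) * (m - b) by rewrite mulr_ge0 ?subr_ge0// ltW.
  have /eqP : t * (m - a) = 0 by lra.
  have /eqP : (1 - t) * (m - b) = 0 by lra.
  by rewrite !mulf_eq0 !(gt_eqF t0) !(gt_eqF t1')/= !subr_eq0 => /eqP <- /eqP <-.
have ph : dotp p u <= h by case: pH => [/ltW|[->]].
have qh : dotp q u <= h by case: qH => [/ltW|[->]].
have [{}ph {}qh] := squeeze _ _ _ ph qh Ed.
have pk : cross u p <= k by case: pH => [|[]]//; rewrite ph ltxx.
have qk : cross u q <= k by case: qH => [|[]]//; rewrite qh ltxx.
have [{}pk {}qk] := squeeze _ _ _ pk qk Ec.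
by split; apply: (eq_dotp_cross u1); rewrite ?ph ?qh ?E2.
Qed.

Lemma disk_hull_le d u i : enorm u = 1 ->
  (forall j, dotp (row j d) u <= dotp (row i d) u) ->
  forall q, disk_hull d q -> dotp q u <= dotp (row i d) u + 1.
Proof.
move=> u1 maxi; apply: (smallest_sub (@convex_halfspace u _)) => x [j _] /= xj.
have := cauchy_schwarz (x - row j d) u; rewrite u1 mulr1 ler_norml => /andP[_].
by rewrite dotpBl; have := maxi j; lra.
Qed.

Lemma disk_hull_frontier d u i : enorm u = 1 ->
  (forall j, dotp (row j d) u <= dotp (row i d) u) ->
  frontier (disk_hull d) (row i d + u).
Proof.
move=> u1 maxi; split.
  apply: subset_closure; apply: sub_gen_smallest; exists i => //=.
  by rewrite addrC addKr u1.
move=> /nbhs_ballP[e /= e0 eK].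
(* The step [k *: u] stays in the sup norm ball but leaves the half-plane of [disk_hull_le]. *)
pose k := e / (1 + `|u|).
have k0 : 0 < k by rewrite divr_gt0// ltr_pwDl.
have /eK : ball (row i d + u) e (row i d + u + k *: u).
  rewrite -ball_normE/= opprD addrA subrr sub0r normrN normrZ gtr0_norm//.
  by rewrite /k mulrAC ltr_pdivrMr ?ltr_pwDl// ltr_pM2l// ltr_pwDl.
move=> /(disk_hull_le u1 maxi); rewrite !dotpDl dotpZl -enorm_sqr u1; lra.
Qed.

Lemma polygon_length_row d (s : seq 'I_n) :
  polygon_length [seq row i d | i <- s] = \sum_(e <- cyclic_pairs s) dist d e.1 e.2.
Proof.
rewrite /polygon_length cyclic_pairs_map big_map.
by apply: eq_bigr.
Qed.

(** Steiner's formula applies because in every unit direction some hull vertex, hence an entry of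
    [s], is a farthest centre. *)
Lemma Per_hull_cycle d s : (0 < n)%N -> hull_cycle d s -> Per d = Per_tilde s d.
Proof.
move=> n0 [_ s_hull s_ccw].
have /choice[v Hv] : forall u, exists i, enorm u = 1 ->
    hull_vertex d i /\ forall j, dotp (row j d) u <= dotp (row i d) u.
  move=> u; have [u1|u1] := eqVneq (enorm u) 1; last first.
    (* Directions that are not unit vectors get an arbitrary index. *)
    by exists (Ordinal n0) => /eqP; rewrite (negPf u1).
  by have [i iv maxi] := hull_vertex_farthest d n0 u1; exists i.
rewrite /Per (boundary_length_parallel_body s_ccw (support := fun u => row (v u) d)).
  by rewrite polygon_length_row.
move=> u u1; have [vv maxv] := Hv u u1; split.
- by apply: (map_f (fun i => row i d)); apply/s_hull.
- by move=> q /mapP[j _ ->].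
- exact: disk_hull_le.
- exact: disk_hull_frontier.
Qed.

End DiskHull.

(** * Solving the contact equations *)

HB.instance Definition _ (R : realType) (m n : nat) := Complete.on 'M[R]_(m, n).

Section NormedFacts.
Context {R : realType}.

(** The map from [z] to [- (t *: F z)] preserves the closed ball of radius [r] and contracts it by
    the factor [t * L]. *)
Lemma perturbation_fixed_point (X : completeNormedModType R) (F : X -> X)
    (r K L t : R) :
  0 <= r -> 0 <= t -> 0 <= L ->
  (forall z, `|z| <= r -> `|F z| <= K) ->
  (forall z z', `|z| <= r -> `|z'| <= r -> `|F z - F z'| <= L * `|z - z'|) ->
  t * K <= r -> t * L < 1 ->
  exists2 z, `|z| <= r & z = - (t *: F z).
Proof.
move=> r0 t0 L0 FK FL tK tL.
pose U := [set z : X | `|z| <= r].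
pose T z := - (t *: F z).
have TU : {homo T : z / U z >-> U z}.
  move=> z /= zr; rewrite /U /T/= normrN normrZ ger0_norm//.
  by apply: le_trans tK; rewrite ler_wpM2l// FK.
have tL0 : 0 <= t * L by rewrite mulr_ge0.
have [|||z Uz Ez] := @banach_fixed_point _ _ U (mkfun_fun TU).
- exists (NngNum tL0); split => // -[x y] [/= Ux Uy].
  rewrite /mkfun /T -opprD normrN -scalerN -scalerDr normrZ ger0_norm// -mulrA.
  by rewrite ler_wpM2l// FL.
- apply: (@preimage_closed _ _ (fun z : X => `|z|) [set x | x <= r]); last exact: closed_le.
  by move=> z _; exact: norm_continuous.
- by exists 0; rewrite /U/= normr0.
- by exists z.
Qed.

Lemma mx_entry_le m n (A : 'M[R]_(m, n)) i j : `|A i j| <= `|A|.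
Proof.
by rewrite [leRHS]/Num.norm /= mx_normrE; apply/bigmax_geP; right; exists (i, j).
Qed.

Lemma mx_norm_le m n (A : 'M[R]_(m, n)) (b : R) : 0 <= b ->
  (forall i j, `|A i j| <= b) -> `|A| <= b.
Proof.
by move=> b0 Ab; rewrite [leLHS]/Num.norm /= mx_normrE; apply/bigmax_leP; split.
Qed.

(** Flattened into the rows of a matrix, a free family has a right inverse, whose columns are the
    dual family. *)
Lemma free_dual m n k (X : k.-tuple 'M[R]_(m, n)) : free X ->
  exists eta : 'I_k -> 'M[R]_(m, n), forall a b,
    \sum_i \sum_j (tnth X a) i j * (eta b) i j = (a == b)%:R.
Proof.
move=> /freeP freeX.
pose A : 'M[R]_(k, m * n) := \matrix_a mxvec (tnth X a).
have /row_freeP[B AB] : row_free A.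
  apply: inj_row_free => v vA; apply/rowP => a; rewrite mxE.
  apply: (freeX (v 0)); apply: (can_inj mxvecK); rewrite linear0 linear_sum -[RHS]vA.
  rewrite mulmx_sum_row; apply: eq_bigr => b _.
  by rewrite linearZ rowK (tnth_nth 0).
exists (fun b => vec_mx (col b B)^T) => a b.
transitivity ((A *m B) a b); last by rewrite AB mxE.
rewrite mxE (reindex _ (curry_mxvec_bij _ _))/= pair_bigA/=.
by apply: eq_bigr => -[i j] _ /=; rewrite !mxE mxvecE.
Qed.

(** The threshold [e] is uniform over [w] near [v], since points of the contact variety are reached
    only in directions close to the rolling one. *)
Lemma descent_direction (V : normedModType R) (f : V -> R) (c v : V) :
  differentiable f c -> 'd f c v < 0 ->
  exists2 e : R, 0 < e & forall (t : R) w, 0 < t < e -> `|w - v| < e ->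
    f (t *: w + c) < f c.
Proof.
move=> df dv; have /diff_locallyxP[cont_df Ef] := df.
(* The remainder is then at most [- t * 'd f c v / 4], which the linear term, below
   [t * 'd f c v / 2], outweighs. *)
pose eps := - 'd f c v / (4 * (`|v| + 1)).
have v1 : 0 < `|v| + 1 by rewrite ltr_wpDl.
have eps0 : 0 < eps by rewrite divr_gt0 ?oppr_gt0// mulr_gt0.
have /eqaddoP/(_ eps eps0)/nbhs_ballP[e1 /= e10 H1] :
  (fun h => f (h + c)) = (fun h => f c + 'd f c h) +o_ (0 : V) id.
  by apply/funext => h; exact: Ef.
have dv2 : 'd f c v < 'd f c v / 2 by lra.
have /nbhs_ballP[e2 /= e20 H2] : \forall w \near v, 'd f c w < 'd f c v / 2.
  exact: (cvgr_lt _ (cont_df v)).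
pose e := Num.min (Num.min e2 1) (e1 / (`|v| + 1)).
exists e; first by rewrite !lt_min e20 ltr01 divr_gt0.
move=> t w /andP[t0]; rewrite /e !lt_min => /andP[_ te1] /andP[/andP[we2 w1] _].
have wv : `|w| < `|v| + 1.
  by have := ler_normD (w - v) v; rewrite subrK; lra.
have dw : 'd f c w < 'd f c v / 2.
  by apply: H2; rewrite -ball_normE/= distrC.
have := H1 (t *: w); rewrite -ball_normE/= sub0r normrN normrZ gtr0_norm//.
have -> : t * `|w| < e1.
  by rewrite ltr_pdivlMr// in te1; apply: le_lt_trans te1; rewrite ler_pM2l// ltW.
move=> /(_ isT); rewrite !fctE linearZ/= -[t *: 'd f c w]/(t * 'd f c w) => H.
have epsE : eps * (`|v| + 1) = - 'd f c v / 4.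
  by rewrite /eps invfM mulrA divfK// gt_eqF.
have : t * (eps * `|w|) <= t * (- 'd f c v / 4).
  by rewrite ler_pM2l// -epsE ler_pM2l// ltW.
have : t * 'd f c w < t * ('d f c v / 2) by rewrite ltr_pM2l.
have : t * 'd f c v < 0 by rewrite pmulr_rlt0.
move: H; rewrite ler_norml => /andP[_].
move: ('d f c v) ('d f c w) => x y; move: (`|w|) => z.
lra.
Qed.

End NormedFacts.

(** * Contact varieties *)

Section Contacts.
Context {R : realType} {n : nat}.
Implicit Types (c d w y : 'M[R]_(n, 2)) (G : rel 'I_n) (e : 'I_n * 'I_n).

Lemma dist_sqr c i j : dist c i j ^+ 2 = dotp (row j c - row i c) (row j c - row i c).
Proof. exact: enorm_sqr. Qed.

Lemma distC c i j : dist c i j = dist c j i.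
Proof. by rewrite /dist /enorm !dotpE !mxE; congr Num.sqrt; lra. Qed.

Lemma dist_eq2 c e : (gap e c = 0) <-> (dist c e.1 e.2 = 2).
Proof.
rewrite /gap; split=> [|->]; last by lra.
move=> E; apply/eqP; rewrite -(@eqrXn2 _ 2) ?enorm_ge0//; apply/eqP; lra.
Qed.

Definition dgap e c w : R := 2 * dotp (row e.2 c - row e.1 c) (row e.2 w - row e.1 w).

Definition gap2 e w : R := dotp (row e.2 w - row e.1 w) (row e.2 w - row e.1 w).

(** The gap is a quadratic polynomial in the configuration, so its second order expansion is
    exact. *)
Lemma gap_expansion e c w (t : R) :
  gap e (t *: w + c) = gap e c + t * dgap e c w + t ^+ 2 * gap2 e w.
Proof. by rewrite /gap /dgap /gap2 !dist_sqr !dotpE !mxE; lra. Qed.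

Lemma dgapD e c w y : dgap e c (w + y) = dgap e c w + dgap e c y.
Proof. by rewrite /dgap !dotpE !mxE; lra. Qed.

Lemma dgapZ e c (a : R) w : dgap e c (a *: w) = a * dgap e c w.
Proof. by rewrite /dgap !dotpE !mxE; lra. Qed.

Lemma dgap_sum e c (I : Type) (r : seq I) (F : I -> 'M[R]_(n, 2)) :
  dgap e c (\sum_(i <- r) F i) = \sum_(i <- r) dgap e c (F i).
Proof.
apply: (big_morph (dgap e c)); first exact: dgapD.
by rewrite -(scale0r 0) dgapZ mul0r.
Qed.

Lemma derive_gap e c w : 'D_w (gap e) c = dgap e c w.
Proof.
apply: cvg_lim => //.
have : (fun h : R => dgap e c w + h * gap2 e w) @ 0^' --> dgap e c w.
  rewrite -[X in _ --> X]addr0 -[X in _ --> _ + X](mul0r (gap2 e w)).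
  apply: cvg_within_filter.
  apply: (@cvgD _ _ _ (nbhs (0 : R)) _ (cst (dgap e c w)) (fun h => h * gap2 e w)).
    exact: cvg_cst.
  by apply: (@cvgM _ _ (nbhs (0 : R)) _ id (cst (gap2 e w))); [exact: cvg_id | exact: cvg_cst].
apply: cvg_trans; apply: near_eq_cvg; near=> h.
have h0 : h != 0 by near: h; exact: nbhs_dnbhs_neq.
rewrite /= gap_expansion -[_ *: _]/(_ * _).
have -> : gap e c + h * dgap e c w + h ^+ 2 * gap2 e w - gap e c =
  h * (dgap e c w + h * gap2 e w) by lra.
by rewrite mulKf.
Unshelve. all: by end_near. Qed.

Lemma grad_dot_gap e c w :
  \sum_k \sum_l grad (gap e) c k l * w k l = dgap e c w.
Proof.
rewrite [in RHS](matrix_sum_delta w) dgap_sum; apply: eq_bigr => k _.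
rewrite dgap_sum; apply: eq_bigr => l _.
by rewrite dgapZ mxE derive_gap mulrC.
Qed.

(** A difference of squares in each coordinate is a product of factors at most [2 * |w - y|] and
    [4 * M]; the two coordinates give [16]. *)
Lemma gap2_lipschitz e w y (M : R) : `|w| <= M -> `|y| <= M ->
  `|gap2 e w - gap2 e y| <= 16 * M * `|w - y|.
Proof.
move=> wM yM.
have -> : gap2 e w - gap2 e y =
  ((w - y) e.2 0 - (w - y) e.1 0) * (w e.2 0 - w e.1 0 + y e.2 0 - y e.1 0) +
  ((w - y) e.2 1 - (w - y) e.1 1) * (w e.2 1 - w e.1 1 + y e.2 1 - y e.1 1).
  by rewrite /gap2 !dotpE !mxE; lra.
have H l : `|((w - y) e.2 l - (w - y) e.1 l) * (w e.2 l - w e.1 l + y e.2 l - y e.1 l)|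
    <= (2 * `|w - y|) * (4 * M).
  rewrite normrM ler_pM//.
    apply: le_trans (ler_normB _ _) _.
    by have := mx_entry_le (w - y) e.1 l; have := mx_entry_le (w - y) e.2 l; lra.
  have := mx_entry_le w e.1 l; have := mx_entry_le w e.2 l.
  have := mx_entry_le y e.1 l; have := mx_entry_le y e.2 l.
  by rewrite !ler_norml => /andP[? ?] /andP[? ?] /andP[? ?] /andP[? ?]; apply/andP; split; lra.
by apply: le_trans (ler_normD _ _) _; have := H 0; have := H 1; lra.
Qed.

(** [edges] lists one orientation of each edge: symmetry supplies the other, and irreflexivity
    excludes loops. *)
Lemma contact_varietyP G d : symmetric G -> irreflexive G ->
  (forall e, e \in edges G -> gap e d = 0) -> contact_variety G d.
Proof.
move=> Gs Gi H i j Gij.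
have mem k l : G k l -> (k < l)%N -> dist d k l = 2.
  move=> Gkl kl; apply: (dist_eq2 d (k, l)).1; apply: H.
  by rewrite mem_filter/= kl Gkl mem_enum.
have [ij|ji|/val_inj ij] := ltngtP i j; first exact: mem.
  by rewrite distC; apply: mem; rewrite // Gs.
by rewrite ij Gi in Gij.
Qed.

Lemma Roll_dgap G c v e : contact_variety G c -> Roll G c v -> e \in edges G ->
  dgap e c v = 0.
Proof.
move=> Gc rv; rewrite mem_filter => /andP[/andP[_ Ge] _].
have := rv _ _ Ge; rewrite /unit_vec dotpZl (Gc _ _ Ge) => /eqP.
by rewrite mulf_eq0 invr_eq0 pnatr_eq0/= => /eqP E; rewrite /dgap E mulr0.
Qed.

(* In the scaling [d = c + t (v + sum_k z_k eta_k)], with [eta] dual to the gap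
   gradients, the contact equations read [z = - t gap2], a contraction for
   small [t]. *)
Lemma contact_variety_tangent G c v : symmetric G -> irreflexive G ->
  regular G c -> Roll G c v -> forall eps : R, 0 < eps ->
  exists t w, [/\ 0 < t < eps, `|w - v| < eps & contact_variety G (t *: w + c)].
Proof.
move=> Gs Gi [Gc frG] rv eps eps0.
pose E := edges G; pose m := size E.
have [eta eta_dual] := @free_dual R n 2 m
  (map_tuple (fun e => grad (gap e) c) (in_tuple E)) frG.
pose S (z : 'rV[R]_m) := \sum_k z 0 k *: eta k.
pose b := \sum_k `|eta k|.
have b0 : 0 <= b by rewrite sumr_ge0.
have S_lip z z' : `|S z - S z'| <= b * `|z - z'|.
  rewrite -sumrB mulr_suml; apply: le_trans (ler_norm_sum _ _ _) _.
  apply: ler_sum => k _; rewrite -scalerBl normrZ mulrC ler_wpM2l//.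
  by have := mx_entry_le (z - z') 0 k; rewrite !mxE.
have S_le z : `|S z| <= b * `|z|.
  have := S_lip z 0; rewrite subr0.
  by rewrite (_ : S 0 = 0) ?subr0// /S big1// => k _; rewrite mxE scale0r.
pose e0 := fun k : 'I_m => tnth (in_tuple E) k.
have dS z k : dgap (e0 k) c (S z) = z 0 k.
  have dual a : dgap (e0 k) c (eta a) = (k == a)%:R.
    by rewrite -grad_dot_gap -eta_dual tnth_map.
  rewrite /S dgap_sum (bigD1 k)//= dgapZ dual eqxx mulr1 big1 ?addr0// => a ak.
  by rewrite dgapZ dual eq_sym (negPf ak) mulr0.
(* For [z] in this ball [S z] is shorter than [eps], which keeps [v + S z] near [v], and shorter
   than [1], which gives the bound [M]. *)
pose r := Num.min eps 1 / (2 * (b + 1)).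
have b1 : 0 < b + 1 by rewrite ltr_wpDl.
have me : 0 < Num.min eps 1 by rewrite lt_min eps0 ltr01.
have r0 : 0 < r by rewrite divr_gt0// mulr_gt0.
have br : b * r < Num.min eps 1.
  have : r * (2 * (b + 1)) = Num.min eps 1 by rewrite divfK// gt_eqF// mulr_gt0.
  by move: (Num.min _ _) me r r0 => x x0 r r0; lra.
pose M := `|v| + 1.
have M0 : 0 < M by rewrite ltr_wpDl.
have SM z : `|z| <= r -> `|v + S z| <= M.
  move=> zr; apply: le_trans (ler_normD _ _) _; rewrite lerD2l.
  apply: le_trans (S_le z) _; apply: le_trans (ler_wpM2l b0 zr) _.
  by apply: ltW; apply: lt_le_trans br _; rewrite ge_min lexx orbT.
pose F (z : 'rV[R]_m) : 'rV[R]_m := \row_k gap2 (e0 k) (v + S z).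
(* Both constants come from [gap2_lipschitz]: [K] by comparison with [0], where [gap2] vanishes, and
   [L] with the Lipschitz constant [b] of [S]. *)
pose K := 16 * M * M; pose L := 16 * M * b.
have K0 : 0 <= K by rewrite !mulr_ge0// ltW.
have L0 : 0 <= L by rewrite !mulr_ge0// ltW.
pose t := Num.min (eps / 2) (Num.min (r / (K + 1)) (1 / (L + 1))).
have K1 : 0 < K + 1 by rewrite ltr_wpDl.
have L1 : 0 < L + 1 by rewrite ltr_wpDl.
have t0 : 0 < t by rewrite /t !lt_min; apply/and3P; split; exact: divr_gt0.
have te : t < eps by rewrite /t gt_min; apply/orP; left; lra.
have tK : t * K <= r.
  have : t <= r / (K + 1) by rewrite /t !ge_min lexx orbT.
  by rewrite ler_pdivlMr//; apply: le_trans; rewrite ler_pM2l//; lra.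
have tL : t * L < 1.
  have : t <= 1 / (L + 1) by rewrite /t !ge_min lexx !orbT.
  by rewrite ler_pdivlMr//; apply: lt_le_trans; rewrite ltr_pM2l//; lra.
have gap20 e : gap2 e 0 = 0 by rewrite /gap2 !dotpE !mxE; lra.
have [||z zr Ez] := @perturbation_fixed_point R _ F r K L t (ltW r0) (ltW t0) L0 _ _ tK tL.
- move=> z zr; apply: mx_norm_le => // i k; rewrite mxE.
  have := gap2_lipschitz (e0 k) (SM z zr) (_ : `|0| <= M).
  rewrite normr0 (ltW M0) gap20 !subr0 => /(_ isT) /le_trans; apply.
  by rewrite ler_wpM2l ?mulr_ge0 ?(ltW M0)// SM.
- move=> z z' zr zr'; apply: mx_norm_le => [|i k]; first by rewrite mulr_ge0.
  rewrite !mxE; apply: le_trans (gap2_lipschitz (e0 k) (SM z zr) (SM z' zr')) _.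
  rewrite opprD addrACA subrr add0r /L -[leRHS]mulrA ler_wpM2l ?S_lip//.
  by rewrite mulr_ge0// ltW.
exists t, (v + S z); split; first by rewrite t0.
  rewrite addrC addKr; apply: le_lt_trans (S_le z) _.
  apply: le_lt_trans (ler_wpM2l b0 zr) _; apply: lt_le_trans br _.
  by rewrite ge_min lexx.
apply: contact_varietyP => // e eE.
have [k ->] : exists k, e = e0 k.
  have ke : (index e E < m)%N by rewrite index_mem.
  by exists (Ordinal ke); rewrite /e0 (tnth_nth e)/= nth_index.
have e0E : e0 k \in E by exact: mem_tnth.
(* What remains is [t * z 0 k + t ^+ 2 * gap2], which the fixed point equation cancels. *)
rewrite gap_expansion dgapD dS (Roll_dgap Gc rv e0E) add0r.
rewrite (dist_eq2 c (e0 k)).2; last first.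
  by move: e0E; rewrite mem_filter => /andP[/andP[_ Gk] _]; exact: Gc.
rewrite [in z 0 k]Ez !mxE; lra.
Qed.

Lemma differentiable_dist c i j : 0 < dist c i j ->
  differentiable (fun d => dist d i j) c.
Proof.
move=> cij.
have -> : (fun d => dist d i j) = Num.sqrt \o (fun d : 'M[R]_(n, 2) =>
    (d j 0 - d i 0) * (d j 0 - d i 0) + (d j 1 - d i 1) * (d j 1 - d i 1)).
  by apply/funext => d /=; rewrite /dist /enorm dotpE !mxE.
apply: differentiable_comp.
  by apply: differentiableD; apply: differentiableM; apply: differentiableB;
    exact: differentiable_coord.
apply/derivable1_diffP; apply: ex_derive; apply: is_derive1_sqrt.
by move: cij; rewrite /dist /enorm dotpE !mxE sqrtr_gt0.
Qed.

Lemma differentiable_Per_tilde s c : packing c -> differentiable (Per_tilde s) c.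
Proof.
move=> pc; apply: differentiableD; last exact: differentiable_cst.
elim: (cyclic_pairs s) => [|[i j] r ih].
  rewrite (_ : (fun _ => _) = cst 0); first exact: differentiable_cst.
  by apply/funext => d; rewrite big_nil.
rewrite (_ : (fun _ => _) =
  (fun d => dist d i j) + (fun d => \sum_(e <- r) dist d e.1 e.2)); last first.
  by apply/funext => d; rewrite big_cons.
apply: differentiableD => //.
have [ij|ij] := eqVneq i j.
  (* A pair [(i, i)], as in a one-vertex cycle, contributes a constant, although the norm is not
     differentiable at [0]. *)
  rewrite ij (_ : (fun _ => _) = cst 0); first exact: differentiable_cst.
  by apply/funext => d; rewrite /dist subrr /enorm dotpE !mxE mulr0 addr0 sqrtr0.
by apply: differentiable_dist; apply: lt_le_trans (pc i j ij).
Qed.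

End Contacts.

(** * Rolling to a smaller perimeter inside the class *)

Theorem proposition4p1 (R : realType) (n : nat) (G : rel 'I_n)
  (G_sym : symmetric G) (G_irr : irreflexive G)
  (s : seq 'I_n) (X : set 'M[R]_(n, 2))
  (X_class : fixed_hull_contact_class G s X)
  (c : 'M[R]_(n, 2))
  (c_relint : relative_interior_regular_point G s X c)
  (descent : exists dc : 'M[R]_(n, 2), Roll G c dc /\ DPer s c dc < 0) :
  ~ class_critical G s c /\ ~ local_minimiser Per X c.
Proof.
have [v [rv dv]] := descent; split; first by move=> /(_ v rv) E; rewrite E ltxx in dv.
have [c0 [_ _ _ _ XE]] := X_class.
have [Xc regc [U0 [oU0 U0c U0_far U0_hull]]] := c_relint.
have [[pc cyc_c] _] : (hull_class s `&` contact_class G) c by rewrite -XE.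
(* Without centres the only direction is [0], along which nothing decreases. *)
have n0 : (0 < n)%N.
  rewrite lt0n; apply/negP => /eqP n0; move: dv.
  suff -> : v = 0 by rewrite /DPer linear0 ltxx.
  by apply/matrixP => i; suff: (i < 0)%N by []; rewrite -n0.
move=> [_ /nbhs_ballP[e1 /= e10 He1]].
have /nbhs_ballP[e2 /= e20 He2] : nbhs c U0 by exact: open_nbhs_nbhs.
have [e3 e30 He3] := descent_direction (differentiable_Per_tilde s pc) dv.
pose k := `|v| + 1; have k0 : 0 < k by rewrite ltr_wpDl.
(* The [1] gives [|w| < k]; then [e1 / k] and [e2 / k] keep [t *: w + c] in the balls for local
   minimality and for [U0]. *)
pose e := Num.min (Num.min e3 1) (Num.min (e1 / k) (e2 / k)).
have e0 : 0 < e.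
  by rewrite /e !lt_min e30 ltr01/=; apply/andP; split; exact: divr_gt0.
have [t [w [/andP[t0 te] we Gd]]] := contact_variety_tangent G_sym G_irr regc rv e0.
move: te we; rewrite !lt_min.
move=> /andP[/andP[te3 _] /andP[te1 te2]] /andP[/andP[we3 w1] _].
set d := t *: w + c in Gd *.
have wk : `|w| < k by have := ler_normD (w - v) v; rewrite subrK /k; lra.
have near_d e' : t < e' / k -> ball c e' d.
  rewrite ltr_pdivlMr// => tk; rewrite -ball_normE/= /d opprD addrCA subrr addr0.
  rewrite normrN normrZ gtr0_norm//; apply: lt_trans tk.
  by rewrite ltr_pM2l.
have U0d : U0 d by apply: He2; exact: near_d.
have far := U0_far d U0d Gd.
(* Contacts have distance exactly two on the variety, and the other pairs stay strictly farther
   inside [U0]. *)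
have pd : packing d.
  move=> i j ij; have [Gij|Gij] := boolP (G i j); first by rewrite Gd.
  by apply: ltW; exact: far.
have [_ cyc_d] : hull_class s d by exact: U0_hull.
have Xd : X d.
  rewrite XE; split=> //; split=> // i j ij; split=> [|Gij]; first exact: Gd.
  exact: far.
have := He1 d (near_d _ te1) Xd.
rewrite (Per_hull_cycle n0 cyc_c) (Per_hull_cycle n0 cyc_d) leNgt.
by rewrite He3// t0.
Qed.
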